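(* Let $U$ be Friedman-reflexive with interpreter-selecting function ${\sf C}$, and let $A$, $B$ be finitely axiomatised theories with $A\rhd B$. Then $U\vdash{\sf C}(A)\to{\sf C}(B)$.
   Context: Theories are first-order theories in finite signature; interpretations may be multi-dimensional and piecewise; $W\rhd D$ means $W$ interprets $D$. A $U$-sentence $C$ is an interpreter of finitely axiomatised $A$ over $U$ iff for all $U$-sentences $B$: $(U+B)\rhd A$ iff $U+B\vdash C$; $U$ is Friedman-reflexive iff every finitely axiomatised $A$ has an interpreter, and ${\sf C}(A)$ denotes a chosen interpreter. *)

(* Defs.v *)
From Stdlib Require List.
From mathcomp Require Import all_boot.
Set Implicit Arguments.
Unset Strict Implicit.
Unset Printing Implicit Defensive.

(* Classical one-sorted first-order logic with identity, with de Bruijn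
   indices for variables: in [All p], index 0 of [p] is the bound variable. *)

Record signature := Signature {
  func : finType;
  func_ar : func -> nat;
  rel_sym : finType;
  rel_ar : rel_sym -> nat
}.

Inductive term (S : signature) : Type :=
| Var of nat
| Func (f : func S) of {ffun 'I_(func_ar f) -> term S}.
Arguments Var {S} _.
Arguments Func {S} f _.

Inductive atom (S : signature) : Type :=
| AEq of term S & term S
| ARel (r : rel_sym S) of {ffun 'I_(rel_ar r) -> term S}.
Arguments ARel {S} r _.

(* The type of atoms is a parameter because the connectives are also used over
   the term-free atoms [flat_atom] below. *)
Inductive qform (At : Type) : Type :=
| Atom of At
| Bot
| Imp of qform At & qform At
| All of qform At.
Arguments Bot {At}.

Section Connectives.
Variable At : Type.
Implicit Types p q : qform At.

Definition Not p := Imp p Bot.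
Definition Top : qform At := Not Bot.
Definition And p q := Not (Imp p (Not q)).
Definition Ex p := Not (All (Not p)).
Definition alls n p := iter n (@All At) p.
Definition exs n p := iter n Ex p.
End Connectives.
Arguments Top {At}.

Definition formula (S : signature) := qform (atom S).

Section Syntax.
Variable S : signature.

Fixpoint subst_term (s : nat -> term S) (t : term S) : term S :=
  match t with
  | Var x => s x
  | Func f ts => Func f [ffun m => subst_term s (ts m)]
  end.

Definition subst_atom (s : nat -> term S) (a : atom S) : atom S :=
  match a with
  | AEq t u => AEq (subst_term s t) (subst_term s u)
  | ARel r ts => ARel r [ffun m => subst_term s (ts m)]
  end.

Definition scons (T : Type) (x : T) (s : nat -> T) (n : nat) : T :=
  if n is m.+1 then s m else x.

Definition shift_term : term S -> term S := subst_term (fun x => Var x.+1).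

Definition up (s : nat -> term S) : nat -> term S :=
  scons (Var 0) (fun x => shift_term (s x)).

Fixpoint subst (s : nat -> term S) (p : formula S) : formula S :=
  match p with
  | Atom a => Atom (subst_atom s a)
  | Bot => Bot
  | Imp p q => Imp (subst s p) (subst s q)
  | All p => All (subst (up s) p)
  end.

Definition shift : formula S -> formula S := subst (fun x => Var x.+1).

Definition subst0 (t : term S) : formula S -> formula S := subst (scons t Var).

(* [closed_formula n p]: all free variables of [p] are among 0, ..., n - 1. *)
Fixpoint closed_term (n : nat) (t : term S) : bool :=
  match t with
  | Var x => x < n
  | Func f ts => [forall m, closed_term n (ts m)]
  end.

Definition closed_atom (n : nat) (a : atom S) : bool :=
  match a with
  | AEq t u => closed_term n t && closed_term n u
  | ARel r ts => [forall m, closed_term n (ts m)]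
  end.

Fixpoint closed_formula (n : nat) (p : formula S) : bool :=
  match p with
  | Atom a => closed_atom n a
  | Bot => true
  | Imp p q => closed_formula n p && closed_formula n q
  | All p => closed_formula n.+1 p
  end.

Record nformula (n : nat) := NFormula {
  nformula_val :> formula S;
  nformula_closed : closed_formula n nformula_val
}.

Definition sentence := nformula 0.

(* A theory is given by its set of axioms, which need not be effective. *)
Definition theory := sentence -> Prop.

Definition extend (T : theory) (a : sentence) : theory :=
  fun p => T p \/ p = a.

Definition finitely_axiomatised (T : theory) : Prop :=
  exists ax : seq sentence, forall p, T p <-> List.In p ax.

(* Classical natural deduction. *)
Inductive derives (T : theory) : seq (formula S) -> formula S -> Prop :=
| D_ax G (p : sentence) : T p -> derives T G p
| D_hyp G p : List.In p G -> derives T G p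
| D_impI G p q : derives T (p :: G) q -> derives T G (Imp p q)
| D_impE G p q : derives T G (Imp p q) -> derives T G p -> derives T G q
| D_raa G p : derives T (Not p :: G) Bot -> derives T G p
| D_allI G p : derives T (map shift G) p -> derives T G (All p)
| D_allE G p t : derives T G (All p) -> derives T G (subst0 t p)
| D_refl G t : derives T G (Atom (AEq t t))
| D_repl G p t u :
    derives T G (Atom (AEq t u)) -> derives T G (subst0 t p) ->
    derives T G (subst0 u p).

Definition proves (T : theory) (p : formula S) : Prop := derives T [::] p.

End Syntax.

(* Term-unwinding: function symbols are eliminated in favour of their graphs,
   so that every atom is of the form x = y, f(x_0, ..) = y or r(x_0, ..). *)

Inductive flat_atom (S : signature) : Type :=
| FEq of nat & nat
| FFun (f : func S) of {ffun 'I_(func_ar f) -> nat} & nat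
| FRel (r : rel_sym S) of {ffun 'I_(rel_ar r) -> nat}.
Arguments FEq {S} _ _.
Arguments FFun {S} f _ _.
Arguments FRel {S} r _.

Definition flat_formula (S : signature) := qform (flat_atom S).

Section Unwinding.
Variable S : signature.

Definition is_var (t : term S) : bool := if t is Var _ then true else false.
Definition var_of (t : term S) : nat := if t is Var x then x else 0.

(* The unwinding of the equation t[xi] = y, where xi renames variables. *)
Fixpoint unwind_eq (xi : nat -> nat) (t : term S) (y : nat) : flat_formula S :=
  match t with
  | Var x => Atom (FEq (xi x) y)
  | Func f ts =>
      let n := func_ar f in
      if [forall m, is_var (ts m)]
      then Atom (FFun f [ffun m => xi (var_of (ts m))] y)
      else exs n
             (And (\big[@And _/Top]_(m < n)
                     unwind_eq (fun x => n + xi x) (ts m) m)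
                  (Atom (FFun f [ffun m => nat_of_ord m] (n + y))))
  end.

Definition unwind_atom (a : atom S) : flat_formula S :=
  match a with
  | AEq t (Var y) => unwind_eq id t y
  | AEq (Var x) u => unwind_eq id u x
  | AEq t u => Ex (And (unwind_eq succn t 0) (unwind_eq succn u 0))
  | ARel r ts =>
      let n := rel_ar r in
      if [forall m, is_var (ts m)]
      then Atom (FRel r [ffun m => var_of (ts m)])
      else exs n
             (And (\big[@And _/Top]_(m < n) unwind_eq (addn n) (ts m) m)
                  (Atom (FRel r [ffun m => nat_of_ord m])))
  end.

Fixpoint unwind (p : formula S) : flat_formula S :=
  match p with
  | Atom a => unwind_atom a
  | Bot => Bot
  | Imp p q => Imp (unwind p) (unwind q)
  | All p => All (unwind p)
  end.

End Unwinding.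

(* Multi-dimensional, piecewise, relativised, parameter-free translations of
   the signature S into the signature S'.  The domain is the disjoint union of
   the pieces; an element of piece i is a tuple of length [tr_dim i] satisfying
   [tr_dom i].  Identity is translated by arbitrary formulas.  A formula that
   translates a symbol has the components of the argument tuples, concatenated
   in order, as variables 0, 1, 2, ...; for a function symbol the value comes
   last. *)
Record translation (S S' : signature) := Translation {
  piece : finType;
  piece0 : piece;
  tr_dim : piece -> nat;
  tr_dom : forall i : piece, nformula S' (tr_dim i);
  tr_eq : forall i j : piece, nformula S' (tr_dim i + tr_dim j);
  tr_func : forall (f : func S) (i : {ffun 'I_(func_ar f) -> piece}) (j : piece),
    nformula S' (\sum_(m < func_ar f) tr_dim (i m) + tr_dim j);
  tr_rel : forall (r : rel_sym S) (i : {ffun 'I_(rel_ar r) -> piece}),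
    nformula S' (\sum_(m < rel_ar r) tr_dim (i m))
}.
Arguments tr_func {S S'} _ f i j.
Arguments tr_rel {S S'} _ r i.

Section Translate.
Variables (S S' : signature) (K : translation S S').

(* A variable of S is translated by a piece together with a tuple of variables
   of S' of the dimension of that piece. *)
Definition block : Type := (piece K * seq nat)%type.
Definition env := nat -> block.

Definition inst (p : formula S') (xs : seq nat) : formula S' :=
  subst (fun m => Var (nth 0 xs m)) p.

Definition shift_env (n : nat) (e : env) : env :=
  fun x => ((e x).1, [seq n + y | y <- (e x).2]).

Definition tr_atom (e : env) (a : flat_atom S) : formula S' :=
  match a with
  | FEq x y => inst (tr_eq (e x).1 (e y).1) ((e x).2 ++ (e y).2)
  | FFun f xs y =>
      inst (tr_func K f [ffun m => (e (xs m)).1] (e y).1)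
           (flatten [seq (e (xs m)).2 | m <- enum 'I_(func_ar f)] ++ (e y).2)
  | FRel r xs =>
      inst (tr_rel K r [ffun m => (e (xs m)).1])
           (flatten [seq (e (xs m)).2 | m <- enum 'I_(rel_ar r)])
  end.

Fixpoint tr_flat (e : env) (p : flat_formula S) : formula S' :=
  match p with
  | Atom a => tr_atom e a
  | Bot => Bot
  | Imp p q => Imp (tr_flat e p) (tr_flat e q)
  | All p =>
      \big[@And _/Top]_(i : piece K)
        alls (tr_dim i)
          (Imp (tr_dom i : formula S')
               (tr_flat (scons (i, iota 0 (tr_dim i))
                               (shift_env (tr_dim i) e)) p))
  end.

(* The environment is immaterial, since p has no free variables. *)
Definition translate (p : sentence S) : formula S' :=
  tr_flat (fun=> (piece0 K, nseq (tr_dim (piece0 K)) 0)) (unwind p).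

End Translate.

(* [interprets W D]: W interprets D.  Since all theorems of D are considered,
   the laws of identity, the non-emptiness of the domain, and the totality and
   functionality of the translated function symbols are included. *)
Definition interprets (S' S : signature) (W : theory S') (D : theory S) : Prop :=
  exists K : translation S S',
    forall p : sentence S, proves D p -> proves W (translate K p).

Definition is_interpreter (S S' : signature) (U : theory S) (A : theory S')
    (C : sentence S) : Prop :=
  forall B : sentence S,
    interprets (extend U B) A <-> proves (extend U B) C.

Definition Friedman_reflexive (S : signature) (U : theory S) : Prop :=
  forall (S' : signature) (A : theory S'), finitely_axiomatised A ->
    exists C : sentence S, is_interpreter U A C.

Definition interpreter_selecting (S : signature) (U : theory S)
    (C : forall S' : signature, theory S' -> sentence S) : Prop :=
  forall (S' : signature) (A : theory S'), finitely_axiomatised A ->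
    is_interpreter U A (C S' A).

(* Main.v *)
(** Over U + C(A) the theory A is interpreted, hence by transitivity so is B,
    whence U + C(A) proves C(B).  Transitivity is purely syntactic: a piece of
    the composite of L and K is a piece of L together with a choice of a piece
    of K for each of its coordinates, and the composite translates each
    primitive of the source by the K-translation of its L-translation.  Then
    translating by L and afterwards by K agrees with the composite up to
    rearranging conjunctions and quantifiers. *)

Require Import Defs.
From mathcomp Require Import all_boot.
Set Implicit Arguments.
Unset Strict Implicit.
Unset Printing Implicit Defensive.

(** * Renaming, substitution and free variables *)

Definition upren (r : nat -> nat) : nat -> nat := scons 0 (fun x => (r x).+1).

Lemma iter_upren_lt r n x : x < n -> iter n upren r x = x.
Proof.
elim: n x => [|n IHn] [|x] //= lt_xn.
by rewrite IHn.
Qed.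

Lemma iter_upren_add r n x : iter n upren r (n + x) = n + r x.
Proof. by elim: n => //= n ->. Qed.

(** Renaming, unwinding and translation all pass through [And] and [Top] by computation, and hence
    through iterated conjunctions. *)
Lemma big_And_morph (At Bt I : Type) (phi : qform At -> qform Bt) (s : seq I)
    (F : I -> qform At) :
  (forall p q, phi (And p q) = And (phi p) (phi q)) -> phi Top = Top ->
  phi (\big[@And At/Top]_(i <- s) F i) = \big[@And Bt/Top]_(i <- s) phi (F i).
Proof. by move=> phiA phi1; exact: (big_morph phi phiA phi1). Qed.

Section Syntax.
Variable S : signature.
Implicit Types (t u : term S) (p q : formula S) (r : nat -> nat).

(* The generated principle gives no hypothesis for the arguments of [Func]. *)
Lemma term_nested_ind (P : term S -> Prop) :
  (forall x, P (Var x)) ->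
  (forall f (ts : {ffun 'I_(func_ar f) -> term S}),
     (forall m, P (ts m)) -> P (Func f ts)) ->
  forall t, P t.
Proof.
move=> PVar PFunc; fix IH 1; case=> [x | f ts]; first exact: PVar.
by apply: PFunc => m; apply: IH.
Qed.

Lemma subst_term_closed n s s' t :
  closed_term n t -> (forall x, x < n -> s x = s' x) ->
  subst_term s t = subst_term s' t.
Proof.
move=> + eq_s; elim/term_nested_ind: t => [x | f ts IH] /=; first exact: eq_s.
move=> /forallP cl; congr Func; apply/ffunP => m; rewrite !ffunE.
exact: IH.
Qed.

Lemma up_closed n (s s' : nat -> term S) :
  (forall x, x < n -> s x = s' x) -> forall x, x < n.+1 -> up s x = up s' x.
Proof. by move=> eq_s [|x] //= lt_xn; rewrite /up /= eq_s. Qed.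

Lemma subst_closed n s s' p :
  closed_formula n p -> (forall x, x < n -> s x = s' x) ->
  subst s p = subst s' p.
Proof.
elim: p n s s' => [[t u|R ts]||p IHp q IHq|p IHp] n s s' /=.
- by move=> /andP[ct cu] eq_s; rewrite !(@subst_term_closed n s s').
- move=> /forallP cl eq_s; congr (Atom (ARel _ _)).
  by apply/ffunP => m; rewrite !ffunE; apply: subst_term_closed eq_s.
- by [].
- by move=> /andP[cp cq] eq_s; rewrite (IHp n s s') // (IHq n s s').
- move=> cp eq_s; rewrite (IHp n.+1 (up s) (up s')) //.
  exact: up_closed.
Qed.

Lemma subst_term_ext s s' t :
  s =1 s' -> subst_term s t = subst_term s' t.
Proof.
move=> eq_s; elim/term_nested_ind: t => [x | f ts IH] //=.
by congr Func; apply/ffunP => m; rewrite !ffunE.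
Qed.

Lemma up_ext (s s' : nat -> term S) : s =1 s' -> up s =1 up s'.
Proof. by move=> eq_s [|x] //=; rewrite /up /= eq_s. Qed.

Lemma subst_ext s s' p : s =1 s' -> subst s p = subst s' p.
Proof.
elim: p s s' => [[t u|R ts]||p IHp q IHq|p IHp] s s' eq_s //=.
- by rewrite !(subst_term_ext _ eq_s).
- congr (Atom (ARel _ _)).
  by apply/ffunP => m; rewrite !ffunE; apply: subst_term_ext.
- by rewrite (IHp s s') // (IHq s s').
- by rewrite (IHp (up s) (up s')) //; apply: up_ext.
Qed.

Lemma subst_term_Var t : subst_term Var t = t.
Proof.
elim/term_nested_ind: t => [x | f ts IH] //=.
by congr Func; apply/ffunP => m; rewrite !ffunE.
Qed.

Lemma subst_Var p : subst Var p = p.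
Proof.
elim: p => [[t u|R ts]||p IHp q IHq|p IHp] //=.
- by rewrite !subst_term_Var.
- by congr (Atom (ARel _ _)); apply/ffunP => m; rewrite ffunE subst_term_Var.
- by rewrite IHp IHq.
- by rewrite -[in RHS]IHp; congr All; apply: subst_ext => -[].
Qed.

Definition ren r p : formula S := subst (fun x => Var (r x)) p.

Lemma up_ren r : up (fun x => Var (r x) : term S) =1 (fun x => Var (upren r x)).
Proof. by case. Qed.

Lemma subst_term_ren s r t :
  subst_term s (subst_term (fun x => Var (r x)) t)
  = subst_term (fun x => s (r x)) t.
Proof.
elim/term_nested_ind: t => [x | f ts IH] //=.
by congr Func; apply/ffunP => m; rewrite !ffunE.
Qed.

(** Since the inner substitution is a renaming, [up s] after [upren r] is pointwise the [up] of the
    composite, so the induction passes under a binder without commuting shifts past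
    substitutions. *)
Lemma subst_ren s r p : subst s (ren r p) = subst (fun x => s (r x)) p.
Proof.
rewrite /ren; elim: p s r => [[t u|R ts]||p IHp q IHq|p IHp] s r //=.
- by rewrite !subst_term_ren.
- congr (Atom (ARel _ _)).
  by apply/ffunP => m; rewrite !ffunE subst_term_ren.
- by rewrite IHp IHq.
- rewrite (subst_ext _ (@up_ren r)) IHp; congr All.
  by apply: subst_ext => -[].
Qed.

Lemma ren_ren r r' p : ren r (ren r' p) = ren (fun x => r (r' x)) p.
Proof. exact: subst_ren. Qed.

Lemma ren_id p : ren id p = p.
Proof. exact: subst_Var. Qed.

Lemma ren_closed n r p :
  closed_formula n p -> (forall x, x < n -> r x = x) -> ren r p = p.
Proof.
move=> cl eq_r; rewrite -[RHS]ren_id; apply: subst_closed cl _ => x lt_xn.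
by rewrite eq_r.
Qed.

Lemma subst0_Var0 p : subst0 (Var 0) (ren (upren succn) p) = p.
Proof.
rewrite /subst0 subst_ren -[RHS]subst_Var.
by apply: subst_ext => -[].
Qed.

Lemma ren_All r p : ren r (All p) = All (ren (upren r) p).
Proof. by congr All; apply: subst_ext => -[]. Qed.

Lemma ren_alls r n p : ren r (alls n p) = alls n (ren (iter n upren r) p).
Proof.
elim: n r => // n IHn r.
by rewrite [alls n.+1 p]/= ren_All IHn iterSr.
Qed.

Lemma ren_big_And (I : Type) r (s : seq I) (F : I -> formula S) :
  ren r (\big[@And _/Top]_(i <- s) F i) = \big[@And _/Top]_(i <- s) ren r (F i).
Proof. exact: big_And_morph. Qed.

Lemma closed_subst_term n m s t :
  closed_term n t -> (forall x, x < n -> closed_term m (s x)) ->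
  closed_term m (subst_term s t).
Proof.
move=> + cl_s; elim/term_nested_ind: t => [x | f ts IH] /=; first exact: cl_s.
by move=> /forallP cl; apply/forallP => i; rewrite ffunE; apply: IH.
Qed.

Lemma closed_ren n m r p :
  closed_formula n p -> (forall x, x < n -> r x < m) ->
  closed_formula m (ren r p).
Proof.
elim: p n m r => [[t u|R ts]||p IHp q IHq|p IHp] n m r //.
- move=> /andP[ct cu] lt_r.
  by apply/andP; split;
    [apply: closed_subst_term ct _ | apply: closed_subst_term cu _].
- move=> /forallP cl lt_r; apply/forallP => i; rewrite ffunE.
  exact: closed_subst_term (cl i) _.
- by move=> /andP[cp cq] lt_r; rewrite /= [_ && _](introT andP) //;
    split; [apply: IHp lt_r | apply: IHq lt_r].
- move=> cp lt_r; rewrite ren_All; apply: (IHp n.+1) => // -[|x] //.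
  exact: lt_r.
Qed.

Lemma closed_alls n m p :
  closed_formula m (alls n p) = closed_formula (n + m) p.
Proof. by elim: n m => //= n IHn m; rewrite IHn addnS. Qed.

Lemma closed_And n p q :
  closed_formula n (And p q) = closed_formula n p && closed_formula n q.
Proof. by rewrite /= !andbT. Qed.

Lemma closed_big_And (I : Type) n (s : seq I) (F : I -> formula S) :
  (forall i, closed_formula n (F i)) ->
  closed_formula n (\big[@And _/Top]_(i <- s) F i).
Proof.
move=> cl; elim/big_ind: _ => // p q cp cq.
by rewrite closed_And cp.
Qed.

Lemma shift_sentence (c : sentence S) : shift c = c.
Proof. exact: ren_closed (nformula_closed c) _. Qed.

End Syntax.

(** * Natural deduction and logical equivalence *)

Section Derivations.
Variable S : signature.
Implicit Types (T : theory S) (p q : formula S) (G : seq (formula S)).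

Lemma derives_weaken T G G' p :
  (forall q, List.In q G -> List.In q G') -> derives T G p -> derives T G' p.
Proof.
move=> + der; elim: der G' => {G p} [G p ?|G p Gp|G p q _ IH|G p q _ IH1 _ IH2
  |G p _ IH|G p _ IH|G p t _ IH|G t|G p t u _ IH1 _ IH2] G' sub.
- exact: D_ax.
- by apply: D_hyp; apply: sub.
- by apply: D_impI; apply: IH => r [->|/sub]; [left | right].
- by apply: D_impE (IH1 _ sub) (IH2 _ sub).
- by apply: D_raa; apply: IH => r [->|/sub]; [left | right].
- apply: D_allI; apply: IH => r.
  by move=> /List.in_map_iff[r0 [<- /sub]]; apply: List.in_map.
- by apply: D_allE; apply: IH.
- exact: D_refl.
- by apply: D_repl (IH1 _ sub) (IH2 _ sub).
Qed.

Lemma derives_cons T G p q : derives T G q -> derives T (p :: G) q.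
Proof. by apply: derives_weaken; right. Qed.

Lemma derives_head T G p : derives T (p :: G) p.
Proof. by apply: D_hyp; left. Qed.

Lemma derives_ImpE T G p q : derives T G (Imp p q) <-> derives T (p :: G) q.
Proof.
split=> [der | ]; last exact: D_impI.
exact: D_impE (derives_cons p der) (derives_head _ _ _).
Qed.

Lemma derives_Top T G : derives T G Top.
Proof. exact/derives_ImpE/derives_head. Qed.

Lemma derives_AndE T G p q :
  derives T G (And p q) <-> derives T G p /\ derives T G q.
Proof.
split=> [der | [der_p der_q]].
  (* [And p q] is the negation of [Imp p (Not q)], and the negation of either conjunct proves that
     implication. *)
  split; apply: D_raa; apply: (D_impE (derives_cons _ der)).
    apply/derives_ImpE/derives_ImpE; apply: (@D_impE _ _ _ p).
      by apply: D_hyp; right; right; left.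
    by apply: D_hyp; right; left.
  by apply/derives_ImpE; apply: derives_cons; apply: derives_head.
apply/derives_ImpE; apply: D_impE (derives_cons _ der_q).
exact: D_impE (derives_head _ _ _) (derives_cons _ der_p).
Qed.

Lemma derives_big_And (I : finType) T G (F : I -> formula S) :
  derives T G (\big[@And _/Top]_i F i) <-> (forall i, derives T G (F i)).
Proof.
suff big_s s : derives T G (\big[@And _/Top]_(i <- s) F i)
               <-> (forall i, i \in s -> derives T G (F i)).
  rewrite big_s; split=> der i; first by apply: der; rewrite mem_index_enum.
  by move=> _; apply: der.
elim: s => [|i s IHs].
  by rewrite big_nil; split=> // _; apply: derives_Top.
rewrite big_cons derives_AndE IHs; split=> [[der_i der_s] j | der].
  by rewrite inE => /predU1P[-> | /der_s].
by split=> [|j js]; apply: der; rewrite inE ?eqxx ?js ?orbT.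
Qed.

(** The form in which a universal hypothesis is used after [D_allI]: that rule shifts the context,
    and instantiating the shifted [All p] at the fresh variable 0 gives back the body. *)
Lemma derives_All_elim T G p : derives T G (shift (All p)) -> derives T G p.
Proof. by rewrite [shift _]ren_All => /(D_allE (Var 0)); rewrite subst0_Var0. Qed.

(** The discharged axiom sits at the far end of the context, out of the way of hypotheses added at
    the head; being closed, it survives the shift in [D_allI]. *)
Lemma deduction T c G p :
  derives (extend T c) G p -> derives T (G ++ [:: nformula_val c]) p.
Proof.
elim=> {G p} [G p [Tp | ->]|G p Gp|G p q _ IH|G p q _ IH1 _ IH2
  |G p _ IH|G p _ IH|G p t _ IH|G t|G p t u _ IH1 _ IH2].
- exact: D_ax.
- by apply: D_hyp; apply: List.in_or_app; right; left.
- by apply: D_hyp; apply: List.in_or_app; left.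
- exact: D_impI.
- exact: D_impE IH1 IH2.
- exact: D_raa.
- by apply: D_allI; rewrite map_cat /= shift_sentence.
- exact: D_allE.
- exact: D_refl.
- exact: D_repl IH1 IH2.
Qed.

(** Quantifying over all theories and contexts makes these relations purely logical and usable under
    a quantifier, where the context is shifted. *)
Definition entails p q := forall T G, derives T G p -> derives T G q.

Definition equiv p q := forall T G, derives T G p <-> derives T G q.

Lemma equiv_entails p q : equiv p q <-> entails p q /\ entails q p.
Proof.
split=> [eq_pq | [pq qp] T G]; last by split=> [/pq | /qp].
by split=> T G /eq_pq.
Qed.

Lemma equiv_refl p : equiv p p.
Proof. by []. Qed.

Lemma equiv_trans q p p' : equiv p q -> equiv q p' -> equiv p p'.
Proof. by move=> e1 e2 T G; rewrite e1 e2. Qed.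

Lemma entails_imp p q : (forall T G, derives T (p :: G) q) -> entails p q.
Proof. by move=> pq T G; apply: D_impE (proj2 (derives_ImpE _ _ _ _) _). Qed.

Lemma entails_hyp p q T G : entails p q -> derives T (p :: G) q.
Proof. by apply; apply: derives_head. Qed.

Lemma equiv_Imp p p' q q' :
  equiv p p' -> equiv q q' -> equiv (Imp p q) (Imp p' q').
Proof.
move=> /equiv_entails[pp' p'p] /equiv_entails[qq' q'q].
apply/equiv_entails; split=> T G der; apply/derives_ImpE.
  apply: qq'; apply: D_impE (derives_cons _ der) _.
  exact: entails_hyp.
apply: q'q; apply: D_impE (derives_cons _ der) _.
exact: entails_hyp.
Qed.

Lemma entails_All p q : entails p q -> entails (All p) (All q).
Proof.
move=> pq; apply: entails_imp => T G; apply: D_allI; apply: pq.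
by apply: derives_All_elim; apply: derives_head.
Qed.

Lemma equiv_alls n p q : equiv p q -> equiv (alls n p) (alls n q).
Proof.
move=> eq_pq; elim: n => //= n /equiv_entails[pq qp].
by apply/equiv_entails; split; apply: entails_All.
Qed.

Lemma equiv_big_And (I : finType) (F F' : I -> formula S) :
  (forall i, equiv (F i) (F' i)) ->
  equiv (\big[@And _/Top]_i F i) (\big[@And _/Top]_i F' i).
Proof.
by move=> eqF T G; rewrite !derives_big_And; split=> der i; apply/eqF.
Qed.

(** This law and those up to [equiv_Imp_Imp] merge nested relativised quantifiers into one block:
    conjunctions over pieces move outwards, quantifiers move in front of relativisers, and
    successive relativisers are conjoined. *)
Lemma equiv_Imp_big_And (I : finType) p (F : I -> formula S) :
  equiv (Imp p (\big[@And _/Top]_i F i)) (\big[@And _/Top]_i Imp p (F i)).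
Proof.
move=> T G; rewrite derives_ImpE !derives_big_And.
by split=> der i; apply/derives_ImpE.
Qed.

Lemma equiv_All_big_And (I : finType) (F : I -> formula S) :
  equiv (All (\big[@And _/Top]_i F i)) (\big[@And _/Top]_i All (F i)).
Proof.
apply/equiv_entails; split.
  move=> T G der; apply/derives_big_And => i.
  by apply: entails_All der => {}T {}G /derives_big_And.
apply: entails_imp => T G; apply: D_allI; apply/derives_big_And => i.
apply: derives_All_elim => /=; rewrite [shift _]ren_big_And.
by apply: (proj1 (derives_big_And _ _ (fun i => ren succn (All (F i)))));
  apply: derives_head.
Qed.

Lemma equiv_alls_big_And (I : finType) n (F : I -> formula S) :
  equiv (alls n (\big[@And _/Top]_i F i)) (\big[@And _/Top]_i alls n (F i)).
Proof.
elim: n => //= n IHn.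
exact: equiv_trans (equiv_alls 1 IHn) (equiv_All_big_And _).
Qed.

Lemma equiv_Imp_All p q : equiv (Imp p (All q)) (All (Imp (shift p) q)).
Proof.
apply/equiv_entails; split; apply: entails_imp => T G.
  apply: D_allI; apply/derives_ImpE; apply: derives_All_elim.
  exact/derives_ImpE/derives_head.
apply/derives_ImpE; apply: D_allI; apply: D_impE (derives_head _ _ _).
by apply: derives_All_elim; apply: derives_cons; apply: derives_head.
Qed.

Lemma equiv_Imp_alls n p q :
  equiv (Imp p (alls n q)) (alls n (Imp (ren (addn n) p) q)).
Proof.
elim: n p => [|n IHn] p; first by rewrite /= [ren _ _]ren_id.
apply: equiv_trans (equiv_Imp_All _ _) _.
have := equiv_alls 1 (IHn (shift p)); rewrite [shift p]/(ren succn p) ren_ren.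
suff -> : ren (fun x => n + x.+1) p = ren (addn n.+1) p by [].
by apply: subst_ext => x; rewrite addnS.
Qed.

Lemma equiv_Imp_Imp p q q' : equiv (Imp p (Imp q q')) (Imp (And p q) q').
Proof.
move=> T G; rewrite !derives_ImpE; split=> der.
  have [der_p der_q] :=
    proj1 (derives_AndE _ _ _ _) (derives_head T G (And p q)).
  apply: D_impE der_q; apply: D_impE der_p.
  by apply: derives_cons; apply/derives_ImpE/derives_ImpE.
have /(D_impE _) : derives T (q :: p :: G) (And p q).
  by apply/derives_AndE; split; [apply: derives_cons|]; apply: derives_head.
by apply; do 2![apply: derives_cons]; apply/derives_ImpE.
Qed.

End Derivations.

(** * Unwinding of terms commutes with renaming and preserves closedness *)

Section Unwinding.
Variable S : signature.
Implicit Types (q : flat_formula S) (t u : term S) (p : formula S).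

Definition fren_atom (r : nat -> nat) (a : flat_atom S) : flat_atom S :=
  match a with
  | FEq x y => FEq (r x) (r y)
  | FFun f xs y => FFun f [ffun m => r (xs m)] (r y)
  | FRel R xs => FRel R [ffun m => r (xs m)]
  end.

Fixpoint fren (r : nat -> nat) q : flat_formula S :=
  match q with
  | Atom a => Atom (fren_atom r a)
  | Bot => Bot
  | Imp q q' => Imp (fren r q) (fren r q')
  | All q => All (fren (upren r) q)
  end.

Lemma fren_exs r n q : fren r (exs n q) = exs n (fren (iter n upren r) q).
Proof.
elim: n r => // n IHn r.
by rewrite [exs n.+1 q]/= /= IHn -iterSr.
Qed.

Lemma fren_big_And (I : Type) r (s : seq I) (F : I -> flat_formula S) :
  fren r (\big[@And _/Top]_(i <- s) F i) = \big[@And _/Top]_(i <- s) fren r (F i).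
Proof. exact: big_And_morph. Qed.

Lemma is_var_ren r t : is_var (subst_term (fun x => Var (r x)) t) = is_var t.
Proof. by case: t. Qed.

Lemma var_of_ren r t :
  is_var t -> var_of (subst_term (fun x => Var (r x)) t) = r (var_of t).
Proof. by case: t. Qed.

Lemma forall_is_var_ren n r (ts : {ffun 'I_n -> term S}) :
  [forall m, is_var ([ffun m => subst_term (fun x => Var (r x)) (ts m)] m)]
  = [forall m, is_var (ts m)].
Proof. by apply: eq_forallb => m; rewrite ffunE is_var_ren. Qed.

(** Subterms are unwound under fresh quantifiers, which offset their variables through [xi]. The
    renaming [r] outside the offset is lifted at each such step while [r'] inside it stays fixed, so
    the induction needs the two to be independent. *)
Lemma unwind_eq_ren (r r' xi xi' : nat -> nat) t y y' :
  y' = r y -> (forall x, r (xi x) = xi' (r' x)) ->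
  fren r (unwind_eq xi t y)
  = unwind_eq xi' (subst_term (fun x => Var (r' x)) t) y'.
Proof.
elim/term_nested_ind: t r xi xi' y y' => [x|f ts IH] r xi xi' y y' -> eq_r /=.
  by rewrite eq_r.
rewrite forall_is_var_ren; case: ifP => [/forallP vars | _].
  rewrite /=; congr (Atom (FFun f _ _)); apply/ffunP => m.
  by rewrite !ffunE var_of_ren.
rewrite fren_exs /= fren_big_And iter_upren_add; congr (exs _ (And _ (Atom _))).
  apply: eq_bigr => m _; rewrite ffunE; apply: IH => [|x].
    by rewrite iter_upren_lt.
  by rewrite iter_upren_add eq_r.
congr (FFun f _ _); apply/ffunP => m; rewrite !ffunE iter_upren_lt //.
Qed.

Lemma unwind_atom_ren r (a : atom S) :
  fren r (unwind_atom a) = unwind_atom (subst_atom (fun x => Var (r x)) a).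
Proof.
case: a => [t [y|g us]|R ts] /=.
- by case: t => [x|f ts]; [ | exact: (@unwind_eq_ren r r id id (Func f ts))].
- case: t => [x|f ts]; first exact: (@unwind_eq_ren r r id id (Func g us)).
  by congr (Ex (And _ _)); [ exact: (@unwind_eq_ren _ r succn succn (Func f ts))
    | exact: (@unwind_eq_ren _ r succn succn (Func g us))].
rewrite forall_is_var_ren; case: ifP => [/forallP vars | _].
  rewrite /=; congr (Atom (FRel R _)); apply/ffunP => m.
  by rewrite !ffunE var_of_ren.
rewrite fren_exs /= fren_big_And; congr (exs _ (And _ (Atom _))).
  apply: eq_bigr => m _; rewrite ffunE; apply: unwind_eq_ren => [|x].
    by rewrite iter_upren_lt.
  by rewrite iter_upren_add.
congr (FRel R _); apply/ffunP => m; rewrite !ffunE iter_upren_lt //.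
Qed.

(** Unwinding branches only on which terms are variables, and a renaming does not change that. *)
Lemma unwind_ren r p : unwind (ren r p) = fren r (unwind p).
Proof.
elim: p r => [a||p IHp q IHq|p IHp] r //.
- by rewrite /= unwind_atom_ren.
- by rewrite /= -IHp -IHq.
- by rewrite ren_All /= IHp.
Qed.

Lemma unwind_alls n p : unwind (alls n p) = alls n (unwind p).
Proof. by elim: n => //= n ->. Qed.

Lemma unwind_big_And (I : Type) (s : seq I) (F : I -> formula S) :
  unwind (\big[@And _/Top]_(i <- s) F i) = \big[@And _/Top]_(i <- s) unwind (F i).
Proof. exact: big_And_morph. Qed.

Definition fclosed_atom (n : nat) (a : flat_atom S) : bool :=
  match a with
  | FEq x y => (x < n) && (y < n)
  | FFun f xs y => [forall m, xs m < n] && (y < n)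
  | FRel R xs => [forall m, xs m < n]
  end.

Fixpoint fclosed (n : nat) q : bool :=
  match q with
  | Atom a => fclosed_atom n a
  | Bot => true
  | Imp q q' => fclosed n q && fclosed n q'
  | All q => fclosed n.+1 q
  end.

Lemma fclosed_And n q q' : fclosed n (And q q') = fclosed n q && fclosed n q'.
Proof. by rewrite /= !andbT. Qed.

Lemma fclosed_big_And (I : Type) n (s : seq I) (F : I -> flat_formula S) :
  (forall i, fclosed n (F i)) -> fclosed n (\big[@And _/Top]_(i <- s) F i).
Proof.
by move=> cl; elim/big_ind: _ => // q q' cq cq'; rewrite fclosed_And cq.
Qed.

Lemma fclosed_exs n m q : fclosed m (exs n q) = fclosed (n + m) q.
Proof. by elim: n m => //= n IHn m; rewrite !andbT IHn addnS. Qed.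

Lemma fclosed_unwind_eq k n (xi : nat -> nat) t y :
  closed_term k t -> (forall x, x < k -> xi x < n) -> y < n ->
  fclosed n (unwind_eq xi t y).
Proof.
elim/term_nested_ind: t n xi y => [x | f ts IH] n xi y /=.
  by move=> lt_xk lt_xi ->; rewrite lt_xi.
move=> /forallP cl lt_xi lt_yn; case: ifP => [/forallP vars | _].
  rewrite /= lt_yn andbT; apply/forallP => m; rewrite ffunE.
  by have := cl m; have := vars m; case: (ts m) => //= x _ /lt_xi.
rewrite fclosed_exs fclosed_And fclosed_big_And /= => [|m].
  rewrite ltn_add2l lt_yn andbT; apply/forallP => m; rewrite ffunE.
  exact: ltn_addr.
by apply: IH => // [x /lt_xi|]; rewrite ?ltn_add2l // ltn_addr.
Qed.

Lemma fclosed_unwind n p : closed_formula n p -> fclosed n (unwind p).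
Proof.
elim: p n => [a||p IHp q IHq|p IHp] n //=; last exact: IHp; last first.
  by move=> /andP[/IHp-> /IHq->].
case: a => [t u|R ts] /=.
  move=> /andP[ct cu]; case: u cu => [y|g us] cu.
    by case: t ct => *; apply: (@fclosed_unwind_eq n).
  case: t ct => [x|f ts] ct; first exact: (@fclosed_unwind_eq n).
  (* The single [Ex] is reread as [exs 1], so that [fclosed_exs] applies. *)
  rewrite -[is_true _]/(is_true (fclosed n (exs 1 (And
    (unwind_eq succn (Func f ts) 0) (unwind_eq succn (Func g us) 0))))).
  rewrite fclosed_exs fclosed_And.
  by apply/andP; split; apply: (@fclosed_unwind_eq n).
move=> /forallP cl; case: ifP => [/forallP vars | _].
  apply/forallP => m; rewrite ffunE.
  by have := cl m; have := vars m; case: (ts m).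
rewrite fclosed_exs fclosed_And fclosed_big_And /= => [|m].
  by apply/forallP => m; rewrite ffunE; apply: ltn_addr.
by apply: (@fclosed_unwind_eq n) => // [x|]; rewrite ?ltn_add2l // ltn_addr.
Qed.

End Unwinding.

(** * Translations: environments, renaming and blocks of quantifiers *)

Section Translate.
Variables (S S' : signature) (K : translation S S').
Implicit Types (e : env K) (q : flat_formula S) (p : formula S) (r : nat -> nat)
  (k : piece K) (ks : seq (piece K)).

(** The type [block] leaves the length of the tuple free; the right length keeps concatenated tuples
    aligned with the variables of the translating formulas. *)
Definition wf_block (b : block K) : Prop := size b.2 = tr_dim b.1.

Definition ren_block r (b : block K) : block K := (b.1, [seq r x | x <- b.2]).

Lemma size_flatten_blocks n (b : 'I_n -> block K) :
  (forall m, wf_block (b m)) ->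
  size (flatten [seq (b m).2 | m <- enum 'I_n])
  = \sum_(m < n) tr_dim ([ffun m => (b m).1] m).
Proof.
move=> wf; rewrite size_flatten sumnE !big_map -enumT big_enum /=.
by apply: eq_bigr => m _; rewrite ffunE wf.
Qed.

(** Positions past the end of [xs] are read as 0, which [r] may move; the closedness of [p']
    together with the length of [xs] excludes them. *)
Lemma ren_inst n r (p' : nformula S' n) xs :
  size xs = n -> ren r (inst p' xs) = inst p' (map r xs).
Proof.
move=> size_xs; rewrite -[inst p' xs]/(ren (nth 0 xs) p') ren_ren.
apply: subst_closed (nformula_closed p') _ => x lt_xn.
by rewrite (nth_map 0) ?size_xs.
Qed.

Lemma closed_inst n m (p' : nformula S' n) xs :
  size xs = n -> all (fun x => x < m) xs -> closed_formula m (inst p' xs).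
Proof.
move=> size_xs /all_nthP lt_xs; apply: closed_ren (nformula_closed p') _ => x.
by rewrite -size_xs => /lt_xs.
Qed.

(* The environment of the body of a quantifier relativised to piece [k]: the
   new block consists of the variables 0, ..., tr_dim k - 1. *)
Definition bind_block k e : env K :=
  scons (k, iota 0 (tr_dim k)) (shift_env (tr_dim k) e).

Lemma wf_bind_block k e n :
  (forall x, x < n -> wf_block (e x)) ->
  forall x, x < n.+1 -> wf_block (bind_block k e x).
Proof.
move=> wf [|x] lt_xn; rewrite /wf_block /= ?size_iota //.
by rewrite size_map wf.
Qed.

Lemma tr_big_And (I : Type) e (s : seq I) (F : I -> flat_formula S) :
  tr_flat e (\big[@And _/Top]_(i <- s) F i)
  = \big[@And _/Top]_(i <- s) tr_flat e (F i).
Proof. exact: big_And_morph. Qed.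

Lemma ren_tr_atom n r e e' (a : flat_atom S) :
  fclosed_atom n a -> (forall x, x < n -> wf_block (e x)) ->
  (forall x, x < n -> e' x = ren_block r (e x)) ->
  ren r (tr_atom e a) = tr_atom e' a.
Proof.
case: a => [x y|f xs y|R xs] /=
  => [/andP[x_n y_n]|/andP[/forallP xs_n y_n]|/forallP xs_n] wf eq_e.
- by rewrite !eq_e // -map_cat ren_inst // size_cat !wf.
- rewrite ren_inst; last first.
    by rewrite size_cat wf // size_flatten_blocks // => m; apply: wf.
  rewrite map_cat map_flatten -map_comp eq_e //.
  have -> : [ffun m => (e' (xs m)).1] = [ffun m => (e (xs m)).1].
    by apply/ffunP => m; rewrite !ffunE eq_e.
  by congr (inst _ (flatten _ ++ _)); apply: eq_map => m /=; rewrite eq_e.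
rewrite ren_inst; last by rewrite size_flatten_blocks // => m; apply: wf.
rewrite map_flatten -map_comp.
have -> : [ffun m => (e' (xs m)).1] = [ffun m => (e (xs m)).1].
  by apply/ffunP => m; rewrite !ffunE eq_e.
by congr (inst _ (flatten _)); apply: eq_map => m /=; rewrite eq_e.
Qed.

(** Target variables enter only through the environment, apart from those of [tr_dom], which are all
    bound by the quantifiers in front and so are fixed by the lifted renaming. *)
Lemma ren_tr_flat n r e e' q :
  fclosed n q -> (forall x, x < n -> wf_block (e x)) ->
  (forall x, x < n -> e' x = ren_block r (e x)) ->
  ren r (tr_flat e q) = tr_flat e' q.
Proof.
elim: q n r e e' => [a||q IHq q' IHq'|q IHq] n r e e'.
- exact: ren_tr_atom.
- by [].
- by move=> /andP[cq cq'] wf eq_e; congr Imp;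
    [apply: (IHq n) | apply: (IHq' n)].
move=> /= cq wf eq_e; rewrite ren_big_And; apply: eq_bigr => k _.
rewrite ren_alls; congr (alls _ (Imp _ _)).
  by apply: ren_closed (nformula_closed _) _ => x; apply: iter_upren_lt.
apply: (IHq n.+1) => // [|[|x] lt_xn]; first exact: wf_bind_block.
  rewrite /ren_block /=; congr pair; rewrite -[LHS]map_id.
  by apply/eq_in_map => x; rewrite mem_iota => /iter_upren_lt->.
rewrite /shift_env /ren_block /= eq_e //=; congr pair; rewrite -!map_comp.
by apply: eq_map => y /=; rewrite iter_upren_add.
Qed.

Lemma tr_flat_closed_ext n e e' q :
  fclosed n q -> (forall x, x < n -> wf_block (e x)) ->
  (forall x, x < n -> e' x = e x) -> tr_flat e q = tr_flat e' q.
Proof.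
move=> cl wf eq_e; rewrite -[LHS]ren_id; apply: ren_tr_flat cl wf _ => x lt_xn.
by rewrite eq_e // /ren_block map_id; case: (e x).
Qed.

Lemma tr_flat_fren r e e' q :
  (forall x, e x = e' (r x)) -> tr_flat e q = tr_flat e' (fren r q).
Proof.
elim: q r e e' => [a||q IHq q' IHq'|q IHq] r e e' eq_e //=; last first.
- apply: eq_bigr => k _; congr (alls _ (Imp _ _)).
  by apply: IHq => -[|x] //=; rewrite /shift_env eq_e.
- by congr Imp; [apply: IHq | apply: IHq'].
case: a => [x y|f xs y|R xs] /=.
- by rewrite !eq_e.
- have -> : [ffun m => (e' ([ffun m => r (xs m)] m)).1]
            = [ffun m => (e (xs m)).1].
    by apply/ffunP => m; rewrite !ffunE eq_e.
  rewrite eq_e; congr (inst _ (flatten _ ++ _)).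
  by apply: eq_map => m; rewrite ffunE eq_e.
have -> : [ffun m => (e' ([ffun m => r (xs m)] m)).1] = [ffun m => (e (xs m)).1].
  by apply/ffunP => m; rewrite !ffunE eq_e.
by congr (inst _ (flatten _)); apply: eq_map => m; rewrite ffunE eq_e.
Qed.

Lemma all_ltn_iota n m b : n + m <= b -> all (fun x => x < b) (iota n m).
Proof.
move=> le_k; apply/allP => x; rewrite mem_iota => /andP[_ lt_x].
exact: leq_trans le_k.
Qed.

Lemma all_ltn_add d m (xs : seq nat) :
  all (fun x => x < m) xs -> all (fun x => x < d + m) [seq d + x | x <- xs].
Proof. by rewrite all_map; apply: sub_all => x /=; rewrite ltn_add2l. Qed.

Lemma closed_tr_flat n m e q :
  fclosed n q -> (forall x, x < n -> wf_block (e x)) ->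
  (forall x, x < n -> all (fun y => y < m) (e x).2) ->
  closed_formula m (tr_flat e q).
Proof.
elim: q n m e => [a||q IHq q' IHq'|q IHq] n m e //; last first.
- move=> /= cq wf lt_m; apply: closed_big_And => k; rewrite closed_alls /=.
  apply/andP; split.
    rewrite -[nformula_val _]ren_id.
    apply: closed_ren (nformula_closed _) _ => x lt_x.
    exact: ltn_addr.
  apply: (IHq n.+1) => // [|[|x] lt_xn]; first exact: wf_bind_block.
    by apply: all_ltn_iota; apply: leq_addr.
  exact/all_ltn_add/lt_m.
- move=> /andP[cq cq'] wf lt_m.
  by apply/andP; split; [apply: (IHq n) | apply: (IHq' n)].
have all_blocks (N : nat) (b : 'I_N -> block K) :
    (forall i, all (fun y => y < m) (b i).2) ->
    all (fun y => y < m) (flatten [seq (b i).2 | i <- enum 'I_N]).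
  by move=> lt_b; apply/allP => y /flatten_mapP[i _ /(allP (lt_b i))].
case: a => [x y|f xs y|R xs] /=
  => [/andP[x_n y_n]|/andP[/forallP xs_n y_n]|/forallP xs_n] wf lt_m.
- by apply: closed_inst; rewrite ?size_cat ?wf // all_cat !lt_m.
- apply: closed_inst.
    by rewrite size_cat wf // size_flatten_blocks // => i; apply: wf.
  by rewrite all_cat lt_m // andbT all_blocks // => i; apply: lt_m.
apply: closed_inst; first by rewrite size_flatten_blocks // => i; apply: wf.
by rewrite all_blocks // => i; apply: lt_m.
Qed.

(** The head of [ks] is the innermost block, so its components have the smallest indices. *)
Fixpoint bind_blocks ks e : env K :=
  if ks is k :: ks then bind_block k (bind_blocks ks e) else e.

Definition dims ks : nat := sumn [seq tr_dim k | k <- ks].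

(** The head comes last in the conjunction because [equiv_Imp_Imp] puts the relativiser of an outer
    block before that of an inner one. *)
Fixpoint doms ks : formula S' :=
  if ks is k :: ks
  then And (ren (addn (tr_dim k)) (doms ks)) (tr_dom k : formula S') else Top.

Lemma dims_cat ks ks' : dims (ks ++ ks') = dims ks + dims ks'.
Proof. by rewrite /dims map_cat sumn_cat. Qed.

Lemma dims_flatten n (kss : 'I_n -> seq (piece K)) :
  dims (flatten [seq kss m | m <- enum 'I_n]) = \sum_(m < n) dims (kss m).
Proof.
rewrite -[RHS]big_enum /= ; elim: (enum _) => [|m s IHs].
  by rewrite big_nil.
by rewrite big_cons -IHs -dims_cat.
Qed.

Lemma closed_doms ks : closed_formula (dims ks) (doms ks).
Proof.
elim: ks => // k ks IHks; rewrite closed_And; apply/andP; split.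
  by apply: closed_ren IHks _ => x; rewrite ltn_add2l.
rewrite -[nformula_val _]ren_id.
apply: closed_ren (nformula_closed _) _ => x lt_x.
exact: ltn_addr.
Qed.

Lemma wf_bind_blocks ks e :
  (forall x, wf_block (e x)) -> forall x, wf_block (bind_blocks ks e x).
Proof.
by move=> wf; elim: ks => // k ks IHks x; apply: (@wf_bind_block _ _ x.+1).
Qed.

Lemma bind_blocks_lt ks e x :
  x < size ks -> all (fun y => y < dims ks) (bind_blocks ks e x).2.
Proof.
elim: ks x => [|k ks IHks] [|x] //= lt_x.
  by apply: all_ltn_iota; apply: leq_addr.
exact/all_ltn_add/IHks.
Qed.

Lemma bind_blocks_lt_ext ks e e' x :
  x < size ks -> bind_blocks ks e x = bind_blocks ks e' x.
Proof.
elim: ks x => // k ks IHks [|x] //= lt_x.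
by rewrite /shift_env IHks.
Qed.

Lemma bind_blocks_add ks e x :
  bind_blocks ks e (size ks + x) = ren_block (addn (dims ks)) (e x).
Proof.
elim: ks => [|k ks IHks] /=.
  by rewrite /ren_block map_id; case: (e x).
rewrite /shift_env IHks /ren_block /= -map_comp; congr pair.
by apply: eq_map => y /=; rewrite addnA.
Qed.

Lemma bind_blocks_fst ks e :
  [seq (bind_blocks ks e x).1 | x <- iota 0 (size ks)] = ks.
Proof.
elim: ks => //= k ks IHks; congr cons.
by rewrite -[1]/(1 + 0) iotaDl -map_comp -[RHS]IHks.
Qed.

Lemma bind_blocks_snd ks e :
  flatten [seq (bind_blocks ks e x).2 | x <- iota 0 (size ks)] = iota 0 (dims ks).
Proof.
elim: ks => //= k ks IHks.
rewrite [dims _]/(tr_dim k + dims ks) iotaD; congr cat.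
rewrite addnC -[1]/(1 + 0) !iotaDl -IHks map_flatten -!map_comp.
by congr flatten; apply: eq_map.
Qed.

(** Any list of blocks is a renaming of the standard blocks for the same pieces, whose components
    are numbered consecutively: the renaming looks up a position in the concatenated tuples. *)
Lemma ren_bind_blocks e e0 xs x :
  (forall x, wf_block (e x)) -> x < size xs ->
  e (nth 0 xs x)
  = ren_block (nth 0 (flatten [seq (e y).2 | y <- xs]))
              (bind_blocks [seq (e y).1 | y <- xs] e0 x).
Proof.
move=> wf; elim: xs x => [|y xs IHxs] [|x] //= lt_x.
  rewrite /ren_block /=; case: (e y) (wf y) => i ys /= <-; congr pair.
  by rewrite map_nth_iota0 ?size_cat ?leq_addr // take_size_cat.
rewrite IHxs // /ren_block /=; congr pair; rewrite -map_comp.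
apply: eq_map => z /=; rewrite nth_cat wf.
by rewrite ltnNge leq_addr addKn.
Qed.

Definition env0 : env K := fun=> (piece0 K, nseq (tr_dim (piece0 K)) 0).

Lemma wf_env0 x : wf_block (env0 x).
Proof. exact: size_nseq. Qed.

(* [p], in variables 0, ..., size ks - 1, translated with variable number m read
   in piece number m of [ks]; the components are the variables
   0, ..., dims ks - 1, in order. *)
Definition lift ks p : formula S' := tr_flat (bind_blocks ks env0) (unwind p).

Lemma closed_lift n m ks p :
  closed_formula n p -> n = size ks -> m = dims ks ->
  closed_formula m (lift ks p).
Proof.
move=> cl size_ks ->; apply: closed_tr_flat (fclosed_unwind cl) _ _ => x lt_xn.
  exact/wf_bind_blocks/wf_env0.
by apply: bind_blocks_lt; rewrite -size_ks.
Qed.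

(** Unwinding commutes with the renaming in [inst], the renaming of source variables reindexes the
    environment, and the result is a renaming of the standard blocks used in [lift]. *)
Lemma tr_inst n e p xs :
  closed_formula n p -> n = size xs -> (forall x, wf_block (e x)) ->
  tr_flat e (unwind (inst p xs))
  = inst (lift [seq (e y).1 | y <- xs] p) (flatten [seq (e y).2 | y <- xs]).
Proof.
move=> cl size_xs wf; rewrite [inst p xs]/(ren (nth 0 xs) p) unwind_ren.
rewrite -(@tr_flat_fren _ (fun x => e (nth 0 xs x))) //.
apply/esym; apply: ren_tr_flat (fclosed_unwind cl) _ _ => x lt_xn.
  exact/wf_bind_blocks/wf_env0.
by apply: ren_bind_blocks; rewrite -?size_xs.
Qed.

(** Each quantifier chooses a piece of [K], so [n] of them choose a tuple of pieces; this produces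
    the choice that enters a piece of the composite. *)
Lemma tr_alls e n q :
  equiv (tr_flat e (alls n q))
    (\big[@And _/Top]_(ks : n.-tuple (piece K))
       alls (dims ks) (Imp (doms ks) (tr_flat (bind_blocks ks e) q))).
Proof.
elim: n q => [|n IHn] q T G.
  rewrite derives_big_And; split=> [der ks | /(_ [tuple])] /=.
    by rewrite (tuple0 ks); apply/derives_ImpE/derives_cons.
  by move/D_impE; apply; apply: derives_Top.
(* The induction adds the innermost quantifier, whose piece therefore becomes the new head of
   [ks]. *)
have step ks : equiv
    (alls (dims ks) (Imp (doms ks) (tr_flat (bind_blocks ks e) (All q))))
    (\big[@And _/Top]_k
       alls (dims (k :: ks))
         (Imp (doms (k :: ks)) (tr_flat (bind_blocks (k :: ks) e) q))).
  apply: equiv_trans (equiv_alls _ (equiv_Imp_big_And _ _)) _.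
  apply: equiv_trans (equiv_alls_big_And _ _) _.
  apply: equiv_big_And => k.
  apply: equiv_trans (equiv_alls _ (equiv_Imp_alls _ _ _)) _.
  rewrite [dims (_ :: _)]addnC /alls iterD.
  by do 2!apply: equiv_alls; apply: equiv_Imp_Imp.
rewrite /alls iterSr; apply: iff_trans (IHn (All q) T G) _.
rewrite !derives_big_And; split=> [der | der ks].
  case/tupleP=> k ks.
  by move: k; apply/derives_big_And/step/der.
by apply/step/derives_big_And => k; apply: (der [tuple of k :: ks]).
Qed.

(** Allows a second translation to be applied, as [translate] accepts only sentences. *)
Lemma closed_translate (p : sentence S) : closed_formula 0 (translate K p).
Proof. by apply: closed_tr_flat (fclosed_unwind (nformula_closed p)) _ _. Qed.

End Translate.

(** * The composite translation *)

Section Compose.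
Variables (SB SA S : signature) (L : translation SB SA) (K : translation SA S).

Definition cpiece : finType :=
  {i : piece L & (tr_dim i).-tuple (piece K)}.

Definition cseq (I : cpiece) : seq (piece K) := tagged I.

Lemma size_cseq (I : cpiece) : size (cseq I) = tr_dim (tag I).
Proof. exact: size_tuple. Qed.

Definition cdim (I : cpiece) : nat := dims (cseq I).

(** Supplies the domain formula of the composite: each coordinate lies in the domain of its piece of
    [K], and jointly they satisfy the translated domain formula of the piece of [L]. *)
Lemma closed_cdom (I : cpiece) :
  closed_formula (cdim I)
    (And (doms (cseq I)) (lift (cseq I) (tr_dom (tag I)))).
Proof.
rewrite closed_And closed_doms.
by rewrite (closed_lift (nformula_closed _)) // size_cseq.
Qed.

Lemma closed_ceq (I J : cpiece) :
  closed_formula (cdim I + cdim J)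
    (lift (cseq I ++ cseq J) (tr_eq (tag I) (tag J))).
Proof.
apply: closed_lift (nformula_closed _) _ _; last by rewrite dims_cat.
by rewrite size_cat !size_cseq.
Qed.

Definition cseqs n (I : {ffun 'I_n -> cpiece}) : seq (piece K) :=
  flatten [seq cseq (I m) | m <- enum 'I_n].

Lemma size_cseqs n (I : {ffun 'I_n -> cpiece}) :
  size (cseqs I) = \sum_(m < n) tr_dim ([ffun m => tag (I m)] m).
Proof.
rewrite size_flatten sumnE !big_map -enumT big_enum /=.
by apply: eq_bigr => m _; rewrite ffunE size_cseq.
Qed.

Lemma closed_cfunc f (I : {ffun 'I_(func_ar f) -> cpiece}) (J : cpiece) :
  closed_formula (\sum_(m < func_ar f) cdim (I m) + cdim J)
    (lift (cseqs I ++ cseq J) (tr_func L f [ffun m => tag (I m)] (tag J))).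
Proof.
apply: closed_lift (nformula_closed _) _ _.
  by rewrite size_cat size_cseqs size_cseq.
by rewrite dims_cat dims_flatten.
Qed.

Lemma closed_crel R (I : {ffun 'I_(rel_ar R) -> cpiece}) :
  closed_formula (\sum_(m < rel_ar R) cdim (I m))
    (lift (cseqs I) (tr_rel L R [ffun m => tag (I m)])).
Proof.
apply: closed_lift (nformula_closed _) _ _; first by rewrite size_cseqs.
by rewrite dims_flatten.
Qed.

Definition compose : translation SB S := {|
  piece := cpiece;
  piece0 := Tagged (fun i : piece L => (tr_dim i).-tuple (piece K))
                   (nseq_tuple (tr_dim (piece0 L)) (piece0 K));
  tr_dim := cdim;
  tr_dom := fun I => NFormula (closed_cdom I);
  tr_eq := fun I J => NFormula (closed_ceq I J);
  tr_func := fun f I J => NFormula (closed_cfunc I J);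
  tr_rel := fun R I => NFormula (closed_crel I)
|}.

(* The composite block [c] is the [L]-block [b] with each of its variables
   replaced by the [K]-block that [e] assigns to it. *)
Definition compose_block (e : env K) (b : block L) (c : block compose) : Prop :=
  [/\ tag c.1 = b.1, cseq c.1 = [seq (e y).1 | y <- b.2]
    & c.2 = flatten [seq (e y).2 | y <- b.2]].

Lemma size_compose_block e b c : compose_block e b c -> size b.2 = tr_dim b.1.
Proof. by case=> <- + _ => /(congr1 size); rewrite size_cseq size_map. Qed.

Lemma flatten_flatten_map (T I : Type) (F : I -> seq (seq T)) (s : seq I) :
  flatten (flatten [seq F i | i <- s]) = flatten [seq flatten (F i) | i <- s].
Proof. by elim: s => //= i s IHs; rewrite flatten_cat IHs. Qed.

(** Both sides instantiate the same lifted formula at the same variables, so for atoms there is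
    equality and not just equivalence. *)
Lemma tr_atom_compose (e : env K) (e' : env L) (c : env compose)
    (a : flat_atom SB) :
  (forall x, wf_block (e x)) -> (forall x, compose_block e (e' x) (c x)) ->
  tr_flat e (unwind (tr_atom e' a)) = tr_atom c a.
Proof.
move=> wf ec.
have size_blocks n (xs : {ffun 'I_n -> nat}) :
    \sum_(m < n) tr_dim ([ffun m => (e' (xs m)).1] m)
    = size (flatten [seq (e' (xs m)).2 | m <- enum 'I_n]).
  rewrite (size_flatten_blocks (b := fun m => e' (xs m))) // => m.
  exact: size_compose_block (ec _).
(* The three clauses of [compose_block], collected over the arguments of a symbol. *)
have tags n (xs : {ffun 'I_n -> nat}) :
    [ffun m => (e' (xs m)).1] = [ffun m => tag ([ffun m => (c (xs m)).1] m)].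
  by apply/ffunP => m; rewrite !ffunE; case: (ec (xs m)).
have pieces n (xs : {ffun 'I_n -> nat}) :
    [seq (e y).1 | y <- flatten [seq (e' (xs m)).2 | m <- enum 'I_n]]
    = cseqs [ffun m => (c (xs m)).1].
  rewrite map_flatten -map_comp; congr flatten; apply: eq_map => m /=.
  by rewrite ffunE; case: (ec (xs m)).
have vars n (xs : {ffun 'I_n -> nat}) :
    flatten [seq (e y).2 | y <- flatten [seq (e' (xs m)).2 | m <- enum 'I_n]]
    = flatten [seq (c (xs m)).2 | m <- enum 'I_n].
  rewrite map_flatten -map_comp flatten_flatten_map; congr flatten.
  by apply: eq_map => m /=; case: (ec (xs m)).
case: a => [x y|f xs y|R xs] /=.
- rewrite (tr_inst (nformula_closed _)) //; last first.
    by rewrite size_cat !(size_compose_block (ec _)).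
  rewrite !map_cat flatten_cat.
  by case: (ec x) (ec y) => <- <- <- [<- <- <-].
- rewrite (tr_inst (nformula_closed _)) //; last first.
    by rewrite size_cat size_blocks (size_compose_block (ec _)).
  rewrite !map_cat flatten_cat pieces vars tags.
  by case: (ec y) => <- <- <-.
rewrite (tr_inst (nformula_closed _)) ?size_blocks //.
by rewrite pieces vars tags.
Qed.

(** At a quantifier the left side is a conjunction over pieces of [L], and [tr_alls] splits each
    conjunct by the choices of pieces of [K]. Such a pair of choices is a piece of the composite,
    and currying merges the two relativisers. *)
Lemma tr_flat_compose (e : env K) (e' : env L) (c : env compose)
    (q : flat_formula SB) :
  (forall x, wf_block (e x)) -> (forall x, compose_block e (e' x) (c x)) ->
  equiv (tr_flat e (unwind (tr_flat e' q))) (tr_flat c q).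
Proof.
elim: q e e' c => [a||q IHq q' IHq'|q IHq] e e' c wf ec.
- by rewrite /= (tr_atom_compose _ wf ec).
- by [].
- by apply: equiv_Imp; [apply: IHq | apply: IHq'].
have step (I : cpiece) : equiv
    (alls (dims (cseq I)) (Imp (doms (cseq I)) (tr_flat (bind_blocks (cseq I) e)
       (unwind (Imp (tr_dom (tag I) : formula SA)
                    (tr_flat (bind_block (tag I) e') q))))))
    (alls (cdim I) (Imp (NFormula (closed_cdom I) : formula S)
       (tr_flat (bind_block (I : piece compose) c) q))).
  (* Below the new blocks [lift] has the environment [env0], here it is [e]; the domain formula
     mentions only variables of the new blocks. *)
  have <- : And (doms (cseq I))
                (tr_flat (bind_blocks (cseq I) e) (unwind (tr_dom (tag I))))
            = NFormula (closed_cdom I) :> formula S.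
    congr And.
    apply: tr_flat_closed_ext (fclosed_unwind (nformula_closed _)) _ _.
      by move=> x _; apply: wf_bind_blocks.
    by move=> x; rewrite -size_cseq; apply: bind_blocks_lt_ext.
  apply: equiv_alls; apply: equiv_trans (equiv_Imp_Imp _ _ _) _.
  apply: equiv_Imp; first exact: equiv_refl.
  (* The new [L]-block 0, 1, ... reads off the blocks of [cseq I] in order; an old one is offset by
     [tr_dim (tag I)] in [L] and so by [dims (cseq I)] in the composite. *)
  apply: IHq => [|[|x]]; first exact: wf_bind_blocks.
    by split; rewrite //= -size_cseq ?bind_blocks_fst ?bind_blocks_snd.
  case: (ec x) => e1 e2 e3; split=> //=.
    rewrite e2 -map_comp; apply: eq_map => y /=.
    by rewrite -size_cseq bind_blocks_add.
  rewrite e3 map_flatten -!map_comp; congr flatten; apply: eq_map => y /=.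
  by rewrite -size_cseq bind_blocks_add.
move=> T G; rewrite [tr_flat e' _]/= unwind_big_And tr_big_And !derives_big_And.
split=> [der I | der i].
  apply/step; move: (der (tag I)); rewrite unwind_alls => /tr_alls.
  by move=> /derives_big_And/(_ (tagged I)).
rewrite unwind_alls; apply/tr_alls/derives_big_And => ks.
pose I : cpiece := Tagged (fun i : piece L => (tr_dim i).-tuple (piece K)) ks.
exact: (proj2 (step I T G) (der I)).
Qed.

Lemma translate_compose (p : sentence SB) (p' : sentence SA) :
  p' = translate L p :> formula SA ->
  equiv (translate K p') (translate compose p).
Proof.
rewrite /translate => ->; apply: tr_flat_compose => [x | x].
  exact: wf_env0.
(* The default environments correspond: concatenated copies of the zero block of [K] form the zero
   block of the composite. *)
split=> //=; rewrite map_nseq //.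
rewrite /cdim /dims /cseq /= map_nseq.
by elim: (tr_dim _) => //= n <-; rewrite nseqD.
Qed.

End Compose.

(** * Transitivity of interpretation and the theorem *)

Lemma interprets_trans (SB SA S : signature) (W : theory S) (A : theory SA)
    (B : theory SB) :
  interprets W A -> interprets A B -> interprets W B.
Proof.
(* Interpretations carry all theorems, so a theorem of [B] goes through [L] to a theorem of [A] and
   through [K] to one of [W]. *)
move=> [K WA] [L AB]; exists (compose L K) => p /AB Ap.
pose p' : sentence SA := NFormula (closed_translate L p).
by apply: (proj1 (@translate_compose _ _ _ L K p p' _ W [::])) => //; apply: WA.
Qed.

Theorem theorem2p3 (S : signature) (U : theory S)
    (C : forall S' : signature, theory S' -> sentence S)
    (hU : Friedman_reflexive U) (hC : interpreter_selecting U C)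
    (SA SB : signature) (A : theory SA) (B : theory SB)
    (hA : finitely_axiomatised A) (hB : finitely_axiomatised B)
    (hAB : interprets A B) :
  proves U (Imp (C SA A : formula S) (C SB B : formula S)).
Proof.
(* The interpreter property of [C SA A] is applied to the extension of [U] by that very sentence. *)
have UA : interprets (extend U (C SA A)) A.
  by apply/(hC _ _ hA); apply: D_ax; right.
apply: D_impI; apply: (@deduction _ _ _ [::]).
exact/(hC _ _ hB)/(interprets_trans UA hAB).
Qed.
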